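(* Let $(\mathcal{R},\oplus,+)$ be a commutative perfect cancellative Banach semi-ring of characteristic $1$ with fixed element $E$. Let $\sim$ be a maximal cancellative congruence on $\mathcal{R}$, and denote by $\pi_0:\mathcal{R}\to\mathcal{R}/\sim$ the projection. 1. Suppose that every element $X_1$ of $\mathcal{R}/\sim$ satisfies $0\le X_1$. Then $\mathcal{R}/\sim\;=\{\lambda\,\pi_0(E):\lambda\in\mathbb{R}^+\}$ and the map $\lambda\,\pi_0(E)\mapsto\lambda$ is an isomorphism of semi-rings $(\mathcal{R}/\sim,\oplus,+)\to(\mathbb{R}^+,\max(\,,),+)$. 2. Suppose that there exists an element $X_1$ of $\mathcal{R}/\sim$ which does not satisfy $0\oplus X_1=X_1$. Then there is an isomorphism of semi-rings (actually semi-fields) $(\mathcal{R}/\sim,\oplus,+)\to(\mathbb{R},\max(\,,),+)$.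
   Context: A commutative semi-ring of characteristic $1$ is a triple $(\mathcal{R},\oplus,+)$ with two associative laws such that: $(\mathcal{R},+)$ is an abelian monoid with identity $0$; $\oplus$ is commutative with $X\oplus X=X$ for all $X$; and $X+(Y\oplus Z)=(X+Y)\oplus(X+Z)$ for all $X,Y,Z$. It is cancellative if $X+Y=X+Z$ implies $Y=Z$, and perfect if for every integer $n\ge1$ the map $X\mapsto nX$ is surjective (in the cancellative case it is then bijective, which defines an action $(t,X)\mapsto tX$ of the positive rationals). Partial order: $X\le Y$ iff $X\oplus Y=Y$. A cancellative $\mathcal{R}$ embeds canonically in its semi-field of fractions $\mathcal{F}=\{X-Y: X,Y\in\mathcal{R}\}$, where $(\mathcal F,+)$ is the group of differences, $(A-B)\oplus(A'-B')=\bigl((A+B')\oplus(A'+B)\bigr)-(B+B')$, and the order is defined by the same rule. Standing assumptions: (i) there is a fixed $E\in\mathcal{R}$ such that for every $X\in\mathcal{R}$ there is $t\in\mathbb{Q}^+$ with $-tE\le X\le tE$ (inequalities in $\mathcal{F}$); (ii) for $X,Y\in\mathcal{R}$ set $r(X-Y)=\inf\{t\in\mathbb{Q}^+: -tE\le X-Y\le tE\}$; then $r(X-Y)=0$ implies $X=Y$. $\mathcal{R}$ is Banach if it is complete for the distance $r(X-Y)$; then the action of the positive rationals extends by continuity to an action of $\mathbb{R}^{+*}=(0,\infty)$ (with $0\cdot X=0$). A congruence on $\mathcal{R}$ is an equivalence relation $\sim$ such that $X\sim Y$ implies $X+Z\sim Y+Z$ and $X\oplus Z\sim Y\oplus Z$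 for all $Z$; it is cancellative if $X+Y\sim X+Z$ implies $Y\sim Z$. The quotient $\mathcal{R}/\sim$ has the induced laws and the order $X_1\le Y_1$ iff $X_1\oplus Y_1=Y_1$. The trivial congruence is the one with a single class. A maximal cancellative congruence is a non-trivial cancellative congruence $\sim$ such that any cancellative congruence $\sim'$ with ($X\sim Y\Rightarrow X\sim'Y$) is either equal to $\sim$ or trivial. For such $\sim$, the quotient inherits the action of $\mathbb{R}^+$: $\lambda\,\pi_0(X)=\pi_0(\lambda X)$. *)

(* Defs.v *)
From HB Require Import structures.
From mathcomp Require Import all_boot all_order all_algebra.
From mathcomp Require Import boolp classical_sets reals.

Set Implicit Arguments.
Unset Strict Implicit.
Unset Printing Implicit Defensive.
Import Order.TTheory GRing.Theory Num.Theory.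
Local Open Scope ring_scope.
Local Open Scope quotient_scope.

Reserved Notation "x ⊕ y" (at level 50, left associativity).

HB.mixin Record Nmodule_isChar1 S of GRing.Nmodule S := {
  oplus : S -> S -> S;
  oplusA : associative oplus;
  oplusC : commutative oplus;
  oplusxx : idempotent_op oplus;
  add_oplusr : right_distributive (@GRing.add S) oplus
}.

(* Commutative semi-rings of characteristic 1: the "product" is [+], the
   "sum" is [⊕]; [⊕] is not required to have a neutral element. *)
#[short(type="char1Type")]
HB.structure Definition Char1 := {S of GRing.Nmodule S & Nmodule_isChar1 S}.

Notation "x ⊕ y" := (oplus x y) : ring_scope.

HB.mixin Record Char1_isCancellative S of Char1 S := {
  add_cancel : forall x y z : S, x + y = x + z -> y = z
}.

#[short(type="cancChar1Type")]
HB.structure Definition CancChar1 := {S of Char1 S & Char1_isCancellative S}.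

HB.mixin Record Char1_isPerfect S of Char1 S := {
  mulrn_surj :
    forall n : nat, (0 < n)%N -> forall y : S, exists x : S, x *+ n = y
}.

#[short(type="perfCancChar1Type")]
HB.structure Definition PerfCancChar1 :=
  {S of CancChar1 S & Char1_isPerfect S}.

Definition c1le (S : char1Type) (x y : S) : Prop := x ⊕ y = y.

Definition char1_iso (S T : char1Type) (f : S -> T) : Prop :=
  [/\ bijective f, f 0 = 0, {morph f : x y / x + y} & {morph f : x y / x ⊕ y}].

Section SemifieldOfFractions.
Variable S : cancChar1Type.
Implicit Types x y z : S.

Lemma add_cancelr x y z : x + z = y + z -> x = y.
Proof. by rewrite ![_ + z]addrC; apply: add_cancel. Qed.

Lemma add_oplusl x y z : (x ⊕ y) + z = (x + z) ⊕ (y + z).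
Proof. by rewrite ![_ + z]addrC add_oplusr. Qed.

(* The pair [(A, B)] stands for [A - B]. *)
Definition frac_eq (p q : S * S) := p.1 + q.2 == q.1 + p.2.

Lemma frac_eq_refl : reflexive frac_eq.
Proof. by move=> p; rewrite /frac_eq. Qed.

Lemma frac_eq_sym : symmetric frac_eq.
Proof. by move=> p q; rewrite /frac_eq eq_sym. Qed.

Lemma frac_eq_trans : transitive frac_eq.
Proof.
move=> q p r /eqP pq /eqP qr; apply/eqP/(@add_cancelr _ _ q.2).
by rewrite addrAC pq addrAC qr addrAC.
Qed.

Canonical frac_equiv := EquivRel frac_eq frac_eq_refl frac_eq_sym frac_eq_trans.

Definition frac := {eq_quot frac_equiv}.
HB.instance Definition _ := Choice.on frac.
HB.instance Definition _ := EqQuotient.on frac.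

Lemma frac_pi_eq (p q : S * S) :
  p.1 + q.2 = q.1 + p.2 -> \pi_frac p = \pi_frac q.
Proof. by move=> pq; apply/eqP; rewrite piE; apply/eqP. Qed.

Lemma frac_eq_pi (p q : S * S) :
  \pi_frac p = \pi_frac q -> p.1 + q.2 = q.1 + p.2.
Proof. by move=> /eqP; rewrite piE => /eqP. Qed.

Definition pre_add (p q : S * S) := (p.1 + q.1, p.2 + q.2).
Definition pre_opp (p : S * S) := (p.2, p.1).
Definition pre_oplus (p q : S * S) :=
  ((p.1 + q.2) ⊕ (q.1 + p.2), p.2 + q.2).

Definition frac_zero : frac := \pi_frac (0, 0).
Definition frac_add (u v : frac) : frac := \pi_frac (pre_add (repr u) (repr v)).
Definition frac_opp (u : frac) : frac := \pi_frac (pre_opp (repr u)).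
Definition frac_oplus (u v : frac) : frac := \pi_frac (pre_oplus (repr u) (repr v)).

Lemma frac_addE p q : frac_add (\pi_frac p) (\pi_frac q) = \pi_frac (pre_add p q).
Proof.
apply: frac_pi_eq => /=.
have /= Hp := frac_eq_pi (reprK (\pi_frac p)).
have /= Hq := frac_eq_pi (reprK (\pi_frac q)).
by rewrite addrACA Hp Hq addrACA.
Qed.

Lemma frac_oppE p : frac_opp (\pi_frac p) = \pi_frac (pre_opp p).
Proof.
apply: frac_pi_eq => /=.
have /= Hp := frac_eq_pi (reprK (\pi_frac p)).
by rewrite addrC -Hp addrC.
Qed.

Lemma frac_oplusE p q : frac_oplus (\pi_frac p) (\pi_frac q) = \pi_frac (pre_oplus p q).
Proof.
apply: frac_pi_eq => /=.
have /= := frac_eq_pi (reprK (\pi_frac p)).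
have /= := frac_eq_pi (reprK (\pi_frac q)).
set p' := repr (\pi_frac p); set q' := repr (\pi_frac q) => Hq Hp.
rewrite !add_oplusl; congr (_ ⊕ _).
  by rewrite addrACA Hp [q'.2 + _]addrC addrACA.
by rewrite [p.2 + q.2]addrC addrACA Hq [RHS](AC (2*2) ((1*4)*(3*2))).
Qed.

Lemma frac_ind (P : frac -> Prop) : (forall p, P (\pi_frac p)) -> forall u, P u.
Proof. by move=> HP u; rewrite -[u]reprK. Qed.

Fact frac_addA : associative frac_add.
Proof.
elim/frac_ind=> p; elim/frac_ind=> q; elim/frac_ind=> r.
by rewrite !frac_addE /pre_add /= !addrA.
Qed.

Fact frac_addC : commutative frac_add.
Proof.
elim/frac_ind=> p; elim/frac_ind=> q.
by rewrite !frac_addE /pre_add [p.1 + _]addrC [p.2 + _]addrC.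
Qed.

Fact frac_add0 : left_id frac_zero frac_add.
Proof.
elim/frac_ind=> p.
by rewrite !frac_addE /pre_add !add0r; case: p.
Qed.

Fact frac_addN : left_inverse frac_zero frac_opp frac_add.
Proof.
elim/frac_ind=> p; rewrite frac_oppE !frac_addE.
by apply: frac_pi_eq; rewrite /= addr0 add0r addrC.
Qed.

HB.instance Definition _ :=
  GRing.isZmodule.Build frac frac_addA frac_addC frac_add0 frac_addN.

Fact frac_oplusA : associative frac_oplus.
Proof.
elim/frac_ind=> p; elim/frac_ind=> q; elim/frac_ind=> r.
rewrite !frac_oplusE; congr (\pi_frac _).
rewrite /pre_oplus /= !add_oplusl !oplusA !addrA; congr (_ ⊕ _ ⊕ _, _).
  by rewrite addrAC.
by rewrite addrAC.
Qed.

Fact frac_oplusC : commutative frac_oplus.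
Proof.
elim/frac_ind=> p; elim/frac_ind=> q.
by rewrite !frac_oplusE /pre_oplus oplusC [p.2 + _]addrC.
Qed.

Fact frac_oplusxx : idempotent_op frac_oplus.
Proof.
elim/frac_ind=> p; rewrite !frac_oplusE; apply: frac_pi_eq.
by rewrite /= oplusxx addrA.
Qed.

Fact frac_add_oplusr : right_distributive (@GRing.add frac) frac_oplus.
Proof.
elim/frac_ind=> p; elim/frac_ind=> q; elim/frac_ind=> r.
rewrite [_ + _ in RHS]frac_addE [_ + \pi_frac r]frac_addE !frac_oplusE.
rewrite [LHS]frac_addE; apply: frac_pi_eq; rewrite /=.
rewrite add_oplusr !add_oplusl; congr (_ ⊕ _).
  by rewrite (AC (1*2*(2*2)) (1*2*(4*3)*(6*(5*7)))).
by rewrite (AC (1*2*(2*2)) (1*2*(4*3)*(6*(5*7)))).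
Qed.

HB.instance Definition _ :=
  Nmodule_isChar1.Build frac frac_oplusA frac_oplusC frac_oplusxx frac_add_oplusr.

Definition frac_inj (x : S) : frac := \pi_frac (x, 0).

End SemifieldOfFractions.

Section RadiusAndScaling.
Variables (K : realType) (R : perfCancChar1Type) (E : R).

Lemma absz_denq_gt0 (t : rat) : (0 < `|denq t|)%N.
Proof. by rewrite absz_gt0 denq_neq0. Qed.

(* For a rational t >= 0 this is the unique Y with d Y = n X, where t = n / d in
   lowest terms; it is only used for t >= 0. *)
Definition rat_scale (t : rat) (X : R) : R :=
  sval (cid (mulrn_surj _ (absz_denq_gt0 t) (X *+ `|numq t|%N))).

Definition within_E (t : rat) (x : frac R) : Prop :=
  c1le (- frac_inj (rat_scale t E)) x /\ c1le x (frac_inj (rat_scale t E)).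

Definition bounded_by_E : Prop :=
  forall X : R, exists2 t : rat, 0 <= t & within_E t (frac_inj X).

Definition radius (x : frac R) : K :=
  inf [set (ratr t : K) | t in [set t : rat | 0 <= t /\ within_E t x]].

Definition distE (X Y : R) : K := radius (frac_inj X - frac_inj Y).

Definition separatedE : Prop := forall X Y : R, distE X Y = 0 -> X = Y.

Definition completeE : Prop :=
  forall u : nat -> R,
    (forall e : K, 0 < e -> exists N : nat, forall m n : nat,
       (N <= m)%N -> (N <= n)%N -> distE (u m) (u n) < e) ->
    exists l : R, forall e : K, 0 < e -> exists N : nat, forall n : nat,
      (N <= n)%N -> distE (u n) l < e.

(* [Y] is the limit of [t X] as the positive rational [t] tends to [a]. *)
Definition scale_limit (a : K) (X Y : R) : Prop :=
  forall e : K, 0 < e -> exists2 d : K, 0 < d & forall t : rat,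
    0 < t -> `|ratr t - a| < d -> distE (rat_scale t X) Y < e.

(* The action of the reals a >= 0; junk for a < 0. *)
Definition real_scale (a : K) (X : R) : R :=
  if a == 0 then 0 else xget 0 [set Y | scale_limit a X Y].

End RadiusAndScaling.

Section Congruences.
Variable S : char1Type.

Record congruence := Congruence {
  congr_rel :> equiv_rel S;
  congr_add : forall X Y Z : S, congr_rel X Y -> congr_rel (X + Z) (Y + Z);
  congr_oplus : forall X Y Z : S, congr_rel X Y -> congr_rel (X ⊕ Z) (Y ⊕ Z)
}.

Definition cancellative_congr (c : congruence) : Prop :=
  forall X Y Z : S, c (X + Y) (X + Z) -> c Y Z.

Definition trivial_congr (c : congruence) : Prop := forall X Y : S, c X Y.

Definition maximal_cancellative (c : congruence) : Prop :=
  [/\ cancellative_congr c, ~ trivial_congr c &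
      forall c' : congruence, cancellative_congr c' ->
        (forall X Y : S, c X Y -> c' X Y) ->
        (forall X Y : S, c' X Y = c X Y) \/ trivial_congr c'].

Variable c : congruence.

Definition quot := {eq_quot c}.
HB.instance Definition _ := Choice.on quot.
HB.instance Definition _ := EqQuotient.on quot.

Definition quot_proj (X : S) : quot := \pi_quot X.

Lemma quot_projP X Y : quot_proj X = quot_proj Y <-> c X Y.
Proof.
by split=> [/eqP|XY]; [rewrite piE | apply/eqP; rewrite piE].
Qed.

Lemma congr_repr X : c (repr (quot_proj X)) X.
Proof. by apply/quot_projP; rewrite /quot_proj reprK. Qed.

Lemma congr_add2 X X' Y Y' : c X X' -> c Y Y' -> c (X + Y) (X' + Y').
Proof.
move=> XX' YY'; apply: (@equiv_trans _ c (X' + Y)); first exact: congr_add.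
by rewrite ![X' + _]addrC; apply: congr_add.
Qed.

Lemma congr_oplus2 X X' Y Y' : c X X' -> c Y Y' -> c (X ⊕ Y) (X' ⊕ Y').
Proof.
move=> XX' YY'; apply: (@equiv_trans _ c (X' ⊕ Y)); first exact: congr_oplus.
by rewrite ![X' ⊕ _]oplusC; apply: congr_oplus.
Qed.

Definition quot_add (x y : quot) : quot := quot_proj (repr x + repr y).
Definition quot_oplus (x y : quot) : quot := quot_proj (repr x ⊕ repr y).

Lemma quot_addE X Y : quot_add (quot_proj X) (quot_proj Y) = quot_proj (X + Y).
Proof. by apply/quot_projP/congr_add2; apply: congr_repr. Qed.

Lemma quot_oplusE X Y :
  quot_oplus (quot_proj X) (quot_proj Y) = quot_proj (X ⊕ Y).
Proof. by apply/quot_projP/congr_oplus2; apply: congr_repr. Qed.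

Lemma quot_ind (P : quot -> Prop) :
  (forall X, P (quot_proj X)) -> forall x, P x.
Proof. by move=> HP x; rewrite -[x]reprK; apply: HP. Qed.

Fact quot_addA : associative quot_add.
Proof.
by elim/quot_ind=> X; elim/quot_ind=> Y; elim/quot_ind=> Z; rewrite !quot_addE addrA.
Qed.

Fact quot_addC : commutative quot_add.
Proof. by elim/quot_ind=> X; elim/quot_ind=> Y; rewrite !quot_addE addrC. Qed.

Fact quot_add0 : left_id (quot_proj 0) quot_add.
Proof. by elim/quot_ind=> X; rewrite quot_addE add0r. Qed.

HB.instance Definition _ := GRing.isNmodule.Build quot quot_addA quot_addC quot_add0.

Fact quot_oplusA : associative quot_oplus.
Proof.
by elim/quot_ind=> X; elim/quot_ind=> Y; elim/quot_ind=> Z; rewrite !quot_oplusE oplusA.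
Qed.

Fact quot_oplusC : commutative quot_oplus.
Proof. by elim/quot_ind=> X; elim/quot_ind=> Y; rewrite !quot_oplusE oplusC. Qed.

Fact quot_oplusxx : idempotent_op quot_oplus.
Proof. by elim/quot_ind=> X; rewrite quot_oplusE oplusxx. Qed.

Fact quot_add_oplusr : right_distributive (@GRing.add quot) quot_oplus.
Proof.
elim/quot_ind=> X; elim/quot_ind=> Y; elim/quot_ind=> Z.
by rewrite quot_oplusE [LHS]quot_addE [_ + quot_proj Y]quot_addE
  [_ + quot_proj Z]quot_addE quot_oplusE add_oplusr.
Qed.

HB.instance Definition _ :=
  Nmodule_isChar1.Build quot quot_oplusA quot_oplusC quot_oplusxx quot_add_oplusr.

End Congruences.

Section MaxPlus.
Variable K : realType.

Definition maxplus : Type := K.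
HB.instance Definition _ := GRing.Zmodule.on maxplus.

Definition maxplus_max (x y : maxplus) : maxplus := Num.max (x : K) (y : K).

Fact maxplus_maxA : associative maxplus_max.
Proof. by move=> x y z; rewrite /maxplus_max maxA. Qed.

Fact maxplus_maxC : commutative maxplus_max.
Proof. by move=> x y; rewrite /maxplus_max maxC. Qed.

Fact maxplus_maxxx : idempotent_op maxplus_max.
Proof. by move=> x; rewrite /maxplus_max maxxx. Qed.

Fact maxplus_add_maxr : right_distributive (@GRing.add maxplus) maxplus_max.
Proof. by move=> x y z; rewrite /maxplus_max (addr_maxr (x : K)). Qed.

HB.instance Definition _ := Nmodule_isChar1.Build maxplus
  maxplus_maxA maxplus_maxC maxplus_maxxx maxplus_add_maxr.

Record nneg_maxplus := NnegMaxplus {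
  nneg_val : K;
  nneg_valP : 0 <= nneg_val
}.

HB.instance Definition _ := [isSub for nneg_val].
HB.instance Definition _ := [Choice of nneg_maxplus by <:].

Definition nneg_zero : nneg_maxplus := NnegMaxplus (lexx 0).
Definition nneg_add (x y : nneg_maxplus) : nneg_maxplus :=
  NnegMaxplus (addr_ge0 (nneg_valP x) (nneg_valP y)).

Fact nneg_addA : associative nneg_add.
Proof. by move=> x y z; apply: val_inj; rewrite /= addrA. Qed.

Fact nneg_addC : commutative nneg_add.
Proof. by move=> x y; apply: val_inj; rewrite /= addrC. Qed.

Fact nneg_add0 : left_id nneg_zero nneg_add.
Proof. by move=> x; apply: val_inj; rewrite /= add0r. Qed.

HB.instance Definition _ :=
  GRing.isNmodule.Build nneg_maxplus nneg_addA nneg_addC nneg_add0.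

Fact nneg_max_subproof (x y : nneg_maxplus) :
  0 <= Num.max (nneg_val x) (nneg_val y).
Proof. by rewrite le_max nneg_valP. Qed.

Definition nneg_max (x y : nneg_maxplus) : nneg_maxplus :=
  NnegMaxplus (nneg_max_subproof x y).

Fact nneg_maxA : associative nneg_max.
Proof. by move=> x y z; apply: val_inj; rewrite /= maxA. Qed.

Fact nneg_maxC : commutative nneg_max.
Proof. by move=> x y; apply: val_inj; rewrite /= maxC. Qed.

Fact nneg_maxxx : idempotent_op nneg_max.
Proof. by move=> x; apply: val_inj; rewrite /= maxxx. Qed.

Fact nneg_add_maxr : right_distributive (@GRing.add nneg_maxplus) nneg_max.
Proof. by move=> x y z; apply: val_inj; rewrite /= addr_maxr. Qed.

HB.instance Definition _ := Nmodule_isChar1.Build nneg_maxplus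
  nneg_maxA nneg_maxC nneg_maxxx nneg_add_maxr.

End MaxPlus.

(* Main.v *)
(* For P < Q in the quotient, "|X - Y| <= n (Q - P) for some n" is a cancellative
   congruence that identifies P and Q, so by maximality it is trivial: every
   strictly positive difference is a strong unit.  As the positive and negative
   parts of a difference are disjoint, the order is total; it is archimedean, so
   Hoelder's construction embeds the quotient into the reals, with pi_0(E) sent
   to 1.  Completeness provides a E for every real a > 0, and a E is sent to a
   because the embedding is monotone; hence the image contains all nonnegative
   reals.  If it also contains a negative real, it is everything. *)
Require Import Defs.
From HB Require Import structures.
From mathcomp Require Import all_boot all_order all_algebra.
From mathcomp Require Import boolp classical_sets reals.
From mathcomp Require Import ring lra.
Import Order.TTheory GRing.Theory Num.Theory.
Local Open Scope ring_scope.
Local Open Scope quotient_scope.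

Local Notation "x ≼ y" := (c1le x y) (at level 70, no associativity).

(** * Order and multiples in a cancellative semi-ring of characteristic 1 *)

Section Order.
Variable S : cancChar1Type.
Implicit Types x y z : S.

Lemma c1le_refl x : x ≼ x.
Proof. exact: oplusxx. Qed.

Lemma c1le_trans y x z : x ≼ y -> y ≼ z -> x ≼ z.
Proof. by rewrite /c1le => xy <-; rewrite oplusA xy. Qed.

Lemma c1le_anti x y : x ≼ y -> y ≼ x -> x = y.
Proof. by move=> xy yx; rewrite -[LHS]yx oplusC. Qed.

Lemma c1le_oplusl x y : x ≼ x ⊕ y.
Proof. by rewrite /c1le oplusA oplusxx. Qed.

Lemma c1le_oplusr x y : y ≼ x ⊕ y.
Proof. by rewrite oplusC; apply: c1le_oplusl. Qed.

Lemma c1le_oplus2 x x' y y' : x ≼ x' -> y ≼ y' -> x ⊕ y ≼ x' ⊕ y'.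
Proof.
rewrite /c1le => {2}<- {2}<-.
by rewrite !oplusA [x ⊕ y ⊕ x']oplusC !oplusA [x' ⊕ x]oplusC.
Qed.

Lemma c1le_add2l z x y : (z + x ≼ z + y) <-> (x ≼ y).
Proof. by rewrite /c1le -add_oplusr; split=> [/add_cancel | ->]. Qed.

Lemma c1le_add2r z x y : (x + z ≼ y + z) <-> (x ≼ y).
Proof. by rewrite ![_ + z]addrC c1le_add2l. Qed.

Lemma c1le_add x x' y y' : x ≼ x' -> y ≼ y' -> x + y ≼ x' + y'.
Proof.
by move=> xx yy; apply: (c1le_trans (x' + y)); [rewrite c1le_add2r | rewrite c1le_add2l].
Qed.

Lemma c1le_addl x y : 0 ≼ y -> x ≼ y + x.
Proof. by move=> y0; rewrite -{1}[x]add0r c1le_add2r. Qed.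

Lemma c1le_mulrn n x y : x ≼ y -> x *+ n ≼ y *+ n.
Proof.
move=> xy; elim: n => [|n IH]; first exact: c1le_refl.
by rewrite !mulrS; apply: c1le_add.
Qed.

Lemma c1le_mulrn_ge0 n x : 0 ≼ x -> 0 ≼ x *+ n.
Proof. by move/(c1le_mulrn n); rewrite mul0rn. Qed.

Lemma c1le_mulrn_nat m n x : 0 ≼ x -> (m <= n)%N -> x *+ m ≼ x *+ n.
Proof.
move=> x0 /subnK <-; rewrite mulrnDr; apply: c1le_addl; exact: c1le_mulrn_ge0.
Qed.

Lemma c1le_mulrn_lt m n x :
  0 ≼ x -> x <> 0 -> x *+ m ≼ x *+ n -> (m <= n)%N.
Proof.
move=> x0 xn0 le_mn; rewrite leqNgt; apply/negP => lt_nm; apply: xn0.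
apply: c1le_anti => //; apply/(c1le_add2r (x *+ n)).
by rewrite add0r -mulrS; apply: c1le_trans le_mn; apply: c1le_mulrn_nat.
Qed.

(* With s = x ⊕ y one has n s = n x ⊕ (y + (n - 1) s), where the first term is
   absorbed by the second as soon as n x ≼ n y; hence n s = y + (n - 1) s. *)
Lemma c1le_mulrn_inv n x y : (0 < n)%N -> x *+ n ≼ y *+ n -> x ≼ y.
Proof.
case: n => // n _ le_n; set s := x ⊕ y.
have sE k : s *+ k.+1 = x *+ k.+1 ⊕ (y + s *+ k).
  elim: k => [|k IH]; first by rewrite mulr0n addr0.
  rewrite mulrS {1}IH add_oplusr {1}/s add_oplusl -mulrS -oplusA; congr (_ ⊕ _).
  rewrite addrCA -mulrS; apply: (iffRL (c1le_add2l y _ _)).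
  by apply: c1le_mulrn; apply: c1le_oplusl.
have : s *+ n.+1 = y + s *+ n.
  rewrite sE; apply: (c1le_trans _ _ _ le_n); rewrite mulrS c1le_add2l.
  by apply: c1le_mulrn; apply: c1le_oplusr.
by rewrite mulrS ![_ + s *+ n]addrC => /add_cancel.
Qed.

Lemma mulrn_inj n x y : (0 < n)%N -> x *+ n = y *+ n -> x = y.
Proof.
by move=> n0 xy; apply: c1le_anti; apply: (c1le_mulrn_inv _ _ _ n0);
  rewrite xy; apply: c1le_refl.
Qed.

End Order.

(* Every strictly positive difference Q - P is a strong unit of the group of
   fractions. *)
Definition archimedean (S : char1Type) : Prop :=
  forall P Q X Y : S, P ≼ Q -> P <> Q -> exists n, X + P *+ n ≼ Y + Q *+ n.

(** * Totality of an Archimedean order and its embedding into the reals *)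

Section Hoelder.
Variables (K : realType) (S : cancChar1Type).
Hypothesis archiS : archimedean S.

(* The positive and negative parts of X - Y are disjoint, so neither can be
   bounded by a multiple of the other unless it vanishes. *)
Lemma archimedean_total (X Y : S) : X ≼ Y \/ Y ≼ X.
Proof.
set m := X ⊕ Y; have [mX|mX] := pselect (X = m).
  by right; rewrite /c1le oplusC.
left; have [n] := archiS _ _ m Y (c1le_oplusl _ _ _ : X ≼ m) mX.
(* The join of the two sides is always (n + 1) m: [m + X *+ n] supplies the term (n + 1) X, and
   [Y + m *+ n] every term containing Y. The inequality thus says m + n m = Y + n m, and cancelling
   n m gives m = Y. *)
have -> : m + X *+ n ≼ Y + m *+ n = (m + m *+ n = Y + m *+ n).
  rewrite /c1le; congr (_ = _).
  elim: n => [|n IH]; first by rewrite !mulr0n !addr0 /m -oplusA oplusxx.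
  have -> : m + m *+ n.+1 = (X + m *+ n.+1) ⊕ (Y + m *+ n.+1).
    by rewrite {1}/m add_oplusl.
  have -> : X + m *+ n.+1 = (m + X *+ n.+1) ⊕ (X + (Y + m *+ n)).
    by rewrite mulrS -IH add_oplusr addrCA -mulrS.
  rewrite -oplusA; congr (_ ⊕ _); symmetry.
  rewrite addrCA mulrS; apply/c1le_add2l/c1le_add2r.
  exact: c1le_oplusl.
by rewrite ![_ + m *+ n]addrC => /add_cancel.
Qed.

Variable e : S.
Hypotheses (e_ge0 : 0 ≼ e) (e_neq0 : e <> 0).

(* The rationals r = (p - q) / n with r e ≼ x. *)
Definition hoelder_set (x : S) : set K :=
  [set r | exists n p q, [/\ (0 < n)%N, e *+ p ≼ x *+ n + e *+ q &
                            r = (p%:R - q%:R) / n%:R]].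

Definition hoelder (x : S) : K := sup (hoelder_set x).

Lemma archimedean_ubound x : exists n, x ≼ e *+ n.
Proof.
have [n] := archiS _ _ x 0 e_ge0 (nesym e_neq0).
by rewrite mul0rn addr0 add0r; exists n.
Qed.

Lemma archimedean_lbound x : exists n, 0 ≼ x + e *+ n.
Proof.
by have [n] := archiS _ _ 0 x e_ge0 (nesym e_neq0); rewrite mul0rn addr0; exists n.
Qed.

Lemma hoelder_set_neq0 x : (hoelder_set x !=set0)%classic.
Proof.
have [n xn] := archimedean_lbound x; exists ((0%:R - n%:R) / 1%:R).
by exists 1%N, 0%N, n; split.
Qed.

(** Multiplying each inequality by the denominator of the other makes the multiples of x cancel.
    What remains compares two multiples of e, hence two natural numbers, because e is positive and
    nonzero. *)
Lemma hoelder_set_ubound x n p q : (0 < n)%N -> x *+ n + e *+ q ≼ e *+ p ->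
  ubound (hoelder_set x) ((p%:R - q%:R) / n%:R).
Proof.
move=> n0 le_p _ [n' [p' [q' [n'0 ge_p' ->]]]].
have : e *+ (p' * n + q * n')%N ≼ e *+ (q' * n + p * n')%N.
  have := c1le_add _ _ _ _ _ (c1le_mulrn _ n _ _ ge_p') (c1le_mulrn _ n' _ _ le_p).
  rewrite !mulrnDl -!mulrnA [(n' * n)%N]mulnC addrCA -[X in _ ≼ X]addrA.
  by rewrite c1le_add2l -!mulrnDr.
move/(c1le_mulrn_lt _ _ _ _ e_ge0 e_neq0); rewrite -(ler_nat K) !natrD !natrM.
move=> le_nat; rewrite ler_pdivrMr ?ltr0n// mulrAC ler_pdivlMr ?ltr0n//; lra.
Qed.

Lemma hoelder_ge x n p q : (0 < n)%N -> e *+ p ≼ x *+ n + e *+ q ->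
  (p%:R - q%:R) / n%:R <= hoelder x.
Proof.
move=> n0 le_p; apply: ub_le_sup; last by exists n, p, q.
have [m xm] := archimedean_ubound x.
by eexists; apply: (@hoelder_set_ubound x 1 m 0) => //; rewrite addr0.
Qed.

Lemma hoelder_le x n p q : (0 < n)%N -> x *+ n + e *+ q ≼ e *+ p ->
  hoelder x <= (p%:R - q%:R) / n%:R.
Proof.
move=> n0 le_p; apply: ge_sup; [exact: hoelder_set_neq0 | exact: hoelder_set_ubound].
Qed.

Lemma floor_c1le y m : 0 ≼ y -> y ≼ e *+ m ->
  exists p, e *+ p ≼ y /\ y ≼ e *+ p.+1.
Proof.
move=> y0; elim: m => [|m IH] ym.
  by exists 0%N; split=> //; apply: c1le_trans ym _; apply: c1le_mulrn_ge0.
by have [/IH //|my] := archimedean_total y (e *+ m); exists m.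
Qed.

(** For positive n this confines [hoelder x] to an interval of length 1 / n. The shift by q e makes
    n x + q e nonnegative, so that its integer part with respect to e is a natural number. *)
Lemma hoelder_bracket x n : exists p q,
  e *+ p ≼ x *+ n + e *+ q /\ x *+ n + e *+ q ≼ e *+ p.+1.
Proof.
have [q xq] := archimedean_lbound (x *+ n).
have [m ym] := archimedean_ubound (x *+ n + e *+ q).
by have [p ?] := floor_c1le _ _ xq ym; exists p, q.
Qed.

Lemma hoelderD : {morph hoelder : x y / x + y}.
Proof.
move=> x y.
(* Adding the brackets of x and y yields an interval of length 2 / (n + 1) that contains both
   [hoelder (x + y)] and [hoelder x + hoelder y]. *)
have approx n : `|hoelder (x + y) - (hoelder x + hoelder y)| <= 2 / n.+1%:R.
  have [p [q [lex gex]]] := hoelder_bracket x n.+1.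
  have [p' [q' [ley gey]]] := hoelder_bracket y n.+1.
  have := hoelder_ge _ _ _ _ (ltn0Sn n) lex; have := hoelder_le _ _ _ _ (ltn0Sn n) gex.
  have := hoelder_ge _ _ _ _ (ltn0Sn n) ley; have := hoelder_le _ _ _ _ (ltn0Sn n) gey.
  have E : (x + y) *+ n.+1 + e *+ (q + q')%N =
      (x *+ n.+1 + e *+ q) + (y *+ n.+1 + e *+ q').
    by rewrite mulrnDl mulrnDr addrACA.
  have := @hoelder_ge (x + y) n.+1 (p + p')%N (q + q')%N (ltn0Sn n).
  have := @hoelder_le (x + y) n.+1 (p.+1 + p'.+1)%N (q + q')%N (ltn0Sn n).
  rewrite E !mulrnDr => /(_ (c1le_add _ _ _ _ _ gex gey)) H1.
  move=> /(_ (c1le_add _ _ _ _ _ lex ley)); move: H1.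
  rewrite -!natr1 !mulrDl !mulNr !mulrDl.
  by rewrite ler_norml; set i := _^-1; lra.
apply/eqP; rewrite -subr_eq0 -normr_le0; apply/ler_addgt0Pl => d d0; rewrite addr0.
have d2 : 0 <= 2 / d by rewrite divr_ge0 ?ltW.
apply: (le_trans (approx (Num.bound (2 / d)))); have := archi_boundP d2.
rewrite ltr_pdivrMr// ler_pdivrMr ?ltr0n// -natr1; nra.
Qed.

Lemma hoelder0 : hoelder 0 = 0.
Proof. by apply: (addrI (hoelder 0)); rewrite -hoelderD !addr0. Qed.

Lemma hoelderMn n : {morph hoelder : x / x *+ n}.
Proof.
by move=> x; elim: n => [|n IH]; rewrite ?mulr0n ?hoelder0// !mulrS hoelderD IH.
Qed.

Lemma hoelder1 : hoelder e = 1.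
Proof.
apply: le_anti; apply/andP; split.
  have := @hoelder_le e 1 1 0 isT; rewrite !addr0 subr0 divr1; apply; exact: c1le_refl.
have := @hoelder_ge e 1 1 0 isT; rewrite !addr0 subr0 divr1; apply; exact: c1le_refl.
Qed.

Lemma le_hoelder x y : x ≼ y -> hoelder x <= hoelder y.
Proof.
move=> xy; apply: ge_sup; first exact: hoelder_set_neq0.
move=> r [n [p [q [n0 le_p ->]]]]; apply: hoelder_ge => //.
by apply: c1le_trans le_p _; rewrite c1le_add2r; apply: c1le_mulrn.
Qed.

(** The Archimedean property for the pair e, 0 gives e + n x <= n y, so the value of n y exceeds
    that of n x by at least 1. *)
Lemma lt_hoelder x y : x ≼ y -> x <> y -> hoelder x < hoelder y.
Proof.
move=> xy neq_xy; have [n] := archiS _ _ e 0 xy neq_xy.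
move/le_hoelder; rewrite !hoelderD hoelder0 !hoelderMn hoelder1 add0r.
rewrite -![hoelder _ *+ _]mulr_natl.
by have : 0 <= n%:R :> K := ler0n _ n; nra.
Qed.

Lemma hoelder_oplus x y : hoelder (x ⊕ y) = Num.max (hoelder x) (hoelder y).
Proof.
have [xy|yx] := archimedean_total x y.
  by rewrite xy; apply/esym/max_idPr/le_hoelder.
by rewrite oplusC yx; apply/esym/max_idPl/le_hoelder.
Qed.

Lemma hoelder_inj : injective hoelder.
Proof.
move=> x y eq_xy; apply: contrapT => neq_xy.
have [xy|yx] := archimedean_total x y.
  by have := lt_hoelder _ _ xy neq_xy; rewrite eq_xy ltxx.
by have := lt_hoelder _ _ yx (nesym neq_xy); rewrite eq_xy ltxx.
Qed.

End Hoelder.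

(** * The action of the nonnegative rationals *)

Section RationalScaling.
Variable R : perfCancChar1Type.
Implicit Types (X Y : R) (s t : rat).

Lemma absz_numq t : 0 <= t -> `|numq t|%N%:R = t * `|denq t|%N%:R :> rat.
Proof.
move=> t0; rewrite -[_%:R]/(`|numq t|%N : int)%:~R -[X in _ * X]/(`|denq t|%N : int)%:~R.
by rewrite absz_denq gez0_abs ?numq_ge0// numqE.
Qed.

Lemma rat_scaleP t X : rat_scale t X *+ `|denq t|%N = X *+ `|numq t|%N.
Proof. by rewrite /rat_scale; case: cid. Qed.

(** Frees [rat_scale] from lowest terms: any fraction n / d equal to t determines it, because
    multiplication by a positive integer is injective. *)
Lemma rat_scaleE (n d : nat) t X Y : (0 < d)%N -> 0 <= t -> t * d%:R = n%:R ->
  Y *+ d = X *+ n -> rat_scale t X = Y.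
Proof.
move=> d0 t0 td Yd; have d'0 := absz_denq_gt0 t.
apply: (@mulrn_inj _ (`|denq t| * d)); first by rewrite muln_gt0 d'0.
rewrite mulrnA rat_scaleP [(`|denq t| * d)%N]mulnC mulrnA Yd -!mulrnA; congr (_ *+ _).
apply/eqP; rewrite -(eqr_nat rat) !natrM absz_numq// -td; apply/eqP; ring.
Qed.

Lemma rat_scaleD s t X : 0 <= s -> 0 <= t ->
  rat_scale (s + t) X = rat_scale s X + rat_scale t X.
Proof.
move=> s0 t0; have ds0 := absz_denq_gt0 s; have dt0 := absz_denq_gt0 t.
apply: (rat_scaleE (`|numq s| * `|denq t| + `|numq t| * `|denq s|)%N
                   (`|denq s| * `|denq t|)%N).
- by rewrite muln_gt0 ds0.
- exact: addr_ge0.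
- rewrite natrD !natrM !absz_numq//; ring.
rewrite mulrnDl mulrnA rat_scaleP mulnC mulrnA rat_scaleP.
by rewrite -!mulrnA -mulrnDr.
Qed.

Lemma rat_scale_ge0 t X : 0 <= t -> 0 ≼ X -> 0 ≼ rat_scale t X.
Proof.
move=> t0 X0; apply: (@c1le_mulrn_inv _ _ _ _ (absz_denq_gt0 t)).
by rewrite mul0rn rat_scaleP; apply: c1le_mulrn_ge0.
Qed.

End RationalScaling.

(** * Order and differences in the semi-field of fractions *)

Section Fractions.
Variable S : cancChar1Type.
Implicit Types X Y Z : S.

Lemma frac_leE (p q : S * S) :
  (\pi_(Defs.frac S) p ≼ \pi_(Defs.frac S) q) <-> (p.1 + q.2 ≼ q.1 + p.2).
Proof.
rewrite {1}/c1le [_ ⊕ _]frac_oplusE; split=> [/frac_eq_pi /=|pq].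
  by rewrite addrA => /add_cancelr.
by apply: frac_pi_eq; rewrite /= pq addrA.
Qed.

Lemma frac_subE X Y : frac_inj X - frac_inj Y = \pi_(Defs.frac S) (X, Y).
Proof.
rewrite /frac_inj [- _]frac_oppE [_ + _]frac_addE.
by rewrite /pre_add /= addr0 add0r.
Qed.

End Fractions.

(** * The distance defined by E and the action of the positive reals on E *)

Section Distance.
Variables (K : realType) (R : perfCancChar1Type) (E : R).
Hypothesis boundedE : bounded_by_E E.
Implicit Types (X Y Z : R) (s t : rat).

(** The condition -tE <= X - Y <= tE moved from the fractions into R, where the estimates below take
    place. *)
Definition close t X Y : Prop :=
  X ≼ Y + rat_scale t E /\ Y ≼ X + rat_scale t E.

Lemma within_EP t X Y : within_E E t (frac_inj X - frac_inj Y) <-> close t X Y.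
Proof.
rewrite /within_E frac_subE /frac_inj [- _]frac_oppE !frac_leE /= add0r addr0.
by rewrite [_ + Y]addrC /close; split=> -[].
Qed.

Lemma bounded_close0 X : exists2 t, 0 <= t & close t X 0.
Proof.
have [t t0 Xt] := boundedE X; exists t => //; apply/within_EP.
by rewrite [frac_inj 0](_ : _ = 0) ?subr0.
Qed.

(** The bound -tE <= E, applied to E itself, makes (1 + t) E nonnegative; after clearing the
    denominator of t, a positive integer is divided out. *)
Lemma E_ge0 : 0 ≼ E.
Proof.
have [t t0 [_]] := bounded_close0 E.
move/(c1le_mulrn _ `|denq t|%N); rewrite mul0rn mulrnDl rat_scaleP -mulrnDr.
rewrite -{1}(mul0rn R (`|denq t| + `|numq t|)%N); apply: c1le_mulrn_inv.
by rewrite addn_gt0 absz_denq_gt0.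
Qed.

Lemma close_sym t X Y : close t X Y -> close t Y X.
Proof. by case. Qed.

Lemma close_trans s t Y X Z : 0 <= s -> 0 <= t ->
  close s X Y -> close t Y Z -> close (s + t) X Z.
Proof.
move=> s0 t0 [XY YX] [YZ ZY]; split; rewrite rat_scaleD//.
  by apply: (c1le_trans _ _ _ _ XY); rewrite [rat_scale s E + _]addrC addrA c1le_add2r.
by apply: (c1le_trans _ _ _ _ ZY); rewrite addrA c1le_add2r.
Qed.

Lemma bounded_close X Y : exists2 t, 0 <= t & close t X Y.
Proof.
have [s s0 Xs] := bounded_close0 X; have [t t0 Yt] := bounded_close0 Y.
by exists (s + t); [exact: addr_ge0 | apply: close_trans Xs (close_sym _ _ _ Yt)].
Qed.

Lemma close_rat_scale s t : 0 <= s -> 0 <= t ->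
  close `|s - t| (rat_scale s E) (rat_scale t E).
Proof.
wlog st : s t / s <= t.
  move=> H s0 t0; have [/H|/ltW/H] := leP s t; first exact.
  by rewrite distrC => H'; apply: close_sym; apply: H'.
move=> s0 t0; rewrite distrC ger0_norm ?subr_ge0//.
have tE : rat_scale t E = rat_scale s E + rat_scale (t - s) E.
  by rewrite -rat_scaleD ?subr_ge0// subrKC.
have ge0 : 0 ≼ rat_scale (t - s) E by apply: rat_scale_ge0 E_ge0; rewrite subr_ge0.
split; last by rewrite -tE; apply: c1le_refl.
rewrite addrC; apply: (c1le_trans _ (rat_scale t E)); last exact: c1le_addl.
by rewrite tE addrC; apply: c1le_addl.
Qed.

(** Trades the infimum for a rational witness, so that estimates reduce to the triangle inequality
    [close_trans]. *)
Lemma distE_lt X Y (d : K) :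
  distE K E X Y < d <-> exists t, [/\ 0 <= t, ratr t < d & close t X Y].
Proof.
split=> [|[t [t0 td XY]]].
  move/inf_lt => /(_ _)[|_ [t [t0 /within_EP XY] <-] td]; last by exists t.
  (* The set must be nonempty, since the infimum of the empty set is the default value 0. *)
  have [t t0 XY] := bounded_close X Y.
  by exists (ratr t), t => //; split=> //; apply/within_EP.
apply: le_lt_trans td; apply: ge_inf.
  by exists 0 => _ [s [s0 _] <-]; rewrite ler0q.
by exists t => //; split=> //; apply/within_EP.
Qed.

Lemma ratr_approx (a d : K) : 0 < a -> 0 < d ->
  exists t : rat, 0 < t /\ `|ratr t - a| < d.
Proof.
move=> a0 d0; have : Num.max 0 (a - d) < a by rewrite gt_max a0 ltrBlDr ltrDl.
move/rat_in_itvoo => [t]; rewrite in_itv /= gt_max => /andP[/andP[t0 tad] ta].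
exists t; split; first by rewrite -(ltr0q K).
by rewrite ltr_norml; apply/andP; split; lra.
Qed.

Lemma invSn_small (d : K) : 0 < d -> exists N, forall n, (N <= n)%N -> n.+1%:R^-1 < d.
Proof.
move=> d0; have d1 : 0 <= d^-1 by rewrite invr_ge0 ltW.
exists (Num.bound d^-1) => n Nn.
rewrite -[d]invrK ltf_pV2 ?posrE ?invr_gt0 ?ltr0n//.
by apply: (lt_le_trans (archi_boundP d1)); rewrite ler_nat leqW.
Qed.

Hypothesis completeE : completeE K E.

(** Rationals t_n tending to a make t_n E a Cauchy sequence, whose limit does not depend on how a is
    approached. *)
Lemma scale_limit_exists (a : K) : 0 < a -> exists Y, scale_limit E a E Y.
Proof.
move=> a0; have approx n : exists t : rat, 0 < t /\ `|ratr t - a| < n.+1%:R^-1.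
  by apply: ratr_approx => //; rewrite invr_gt0 ltr0n.
have [t tP] := choice approx.
have ratr_close (s s' : rat) (d d' : K) : 0 < s -> 0 < s' ->
    `|ratr s - a| < d -> `|ratr s' - a| < d' ->
    [/\ 0 <= `|s - s'|, ratr `|s - s'| < d + d' &
        close `|s - s'| (rat_scale s E) (rat_scale s' E)].
  move=> s0 s'0 sd s'd; split=> //; last by apply: close_rat_scale; apply: ltW.
  rewrite ratr_norm rmorphB /=; move: sd s'd.
  by rewrite !ltr_norml => /andP[? ?] /andP[? ?]; apply/andP; split; lra.
have [d d0|Y limY] := completeE (fun n => rat_scale (t n) E).
  have [N NP] := invSn_small (d / 2) (divr_gt0 d0 (ltr0n _ 2)).
  exists N => m n Nm Nn; apply/distE_lt; exists `|t m - t n|.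
  have [tm0 tma] := tP m; have [tn0 tna] := tP n.
  rewrite [d]splitr; apply: ratr_close => //.
    by apply: lt_trans tma (NP _ Nm).
  by apply: lt_trans tna (NP _ Nn).
(* The error d splits into d / 4 for |s - a|, d / 4 for |t_n - a| and d / 2 for the distance from
   t_n E to Y. *)
exists Y => d d0; have d4 : 0 < d / 4 by rewrite divr_gt0.
have [N1 N1P] := invSn_small _ d4.
have [N2 N2P] := limY (d / 2) (divr_gt0 d0 (ltr0n _ 2)).
exists (d / 4) => // s s0 sa; set n := maxn N1 N2.
have [r [r0 rd rY]] := iffLR (distE_lt _ _ _) (N2P n (leq_maxr _ _)).
have [tn0 tna] := tP n.
have [q0 qd qY] := ratr_close _ _ _ _ s0 tn0 sa (lt_trans tna (N1P n (leq_maxl _ _))).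
apply/distE_lt; exists (`|s - t n| + r); split; first exact: addr_ge0.
  by rewrite rmorphD /=; lra.
by apply: close_trans qY rY.
Qed.

Lemma real_scaleP (a : K) : 0 < a -> scale_limit E a E (real_scale E a E).
Proof.
move=> a0; rewrite /real_scale gt_eqF//; exact: xgetPex (scale_limit_exists a a0).
Qed.

(* A monotone additive map normalised at E is 1-Lipschitz for distE, hence
   commutes with the limit defining the action of the reals. *)
Lemma real_scale_char (f : R -> K) (a : K) : 0 <= a ->
    {morph f : X Y / X + Y} -> (forall X Y, X ≼ Y -> f X <= f Y) -> f E = 1 ->
  f (real_scale E a E) = a.
Proof.
move=> a_ge0 fD f_le fE.
have f0 : f 0 = 0 by apply: (addrI (f 0)); rewrite -fD !addr0.
have fMn n X : f (X *+ n) = f X *+ n.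
  by elim: n => [|n IH]; rewrite ?mulr0n// !mulrS fD IH.
have f_rat t : 0 <= t -> f (rat_scale t E) = ratr t.
  move=> t0; apply: (@mulIf _ (`|denq t|%N%:R)).
    by rewrite pnatr_eq0 -lt0n absz_denq_gt0.
  rewrite mulr_natr -fMn rat_scaleP fMn fE.
  by rewrite -[X in _ * X](ratr_nat K) -rmorphM /= -absz_numq// ratr_nat.
have [->|a_neq0] := eqVneq a 0; first by rewrite /real_scale eqxx.
have a0 : 0 < a by rewrite lt0r a_neq0.
have approx d : 0 < d -> `|f (real_scale E a E) - a| <= d.
  move=> d0; have d2 : 0 < d / 2 by rewrite divr_gt0.
  have [d' d'0 limP] := real_scaleP _ a0 _ d2.
  (* One rational t controls both errors: |t - a| < d / 2, and the values of [f] at tE and at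
     [real_scale E a E] differ by less than d / 2. *)
  have : 0 < Num.min d' (d / 2) by rewrite lt_min d'0.
  move/(ratr_approx _ _ a0) => [t [t0]]; rewrite lt_min => /andP[/(limP _ t0)].
  move/distE_lt => [r [r0 rd [/f_le + /f_le]]]; rewrite !fD !f_rat ?(ltW t0)// => le1 le2.
  by rewrite ltr_norml ler_norml => /andP[? ?]; apply/andP; split; lra.
apply/eqP; rewrite -subr_eq0 -normr_le0; apply/ler_addgt0Pl => d d0.
by rewrite addr0 approx.
Qed.

End Distance.

(** * The projection onto the quotient *)

Section Quotient.
Variables (S : char1Type) (c : congruence S).

Lemma quot_projD X Y : quot_proj c (X + Y) = quot_proj c X + quot_proj c Y.
Proof. by rewrite [RHS]quot_addE. Qed.

Lemma quot_proj_oplus X Y : quot_proj c (X ⊕ Y) = quot_proj c X ⊕ quot_proj c Y.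
Proof. by rewrite [RHS]quot_oplusE. Qed.

Lemma quot_projMn n X : quot_proj c (X *+ n) = quot_proj c X *+ n.
Proof. by elim: n => [|n IH] //; rewrite !mulrS quot_projD IH. Qed.

Lemma quot_proj_le X Y : X ≼ Y -> quot_proj c X ≼ quot_proj c Y.
Proof. by rewrite /c1le -quot_proj_oplus => ->. Qed.

Lemma quot_add_cancel : cancellative_congr c ->
  forall x y z : quot c, x + y = x + z -> y = z.
Proof.
move=> canc; elim/quot_ind=> X; elim/quot_ind=> Y; elim/quot_ind=> Z.
by rewrite -!quot_projD => /quot_projP /canc /quot_projP.
Qed.

End Quotient.

(** * The congruence generated by a positive difference, and maximality *)

Section UnitCongruence.
Variables (S : char1Type) (T : cancChar1Type) (f : S -> T).
Hypotheses (fD : {morph f : X Y / X + Y}) (f_oplus : {morph f : X Y / X ⊕ Y}).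
Variables P Q : T.
Hypothesis PQ : P ≼ Q.

(* The pull-back along f of the congruence |X - Y| ≼ n (Q - P) for some n. *)
Definition unit_rel : rel S := fun X Y =>
  `[< exists n, f X + P *+ n ≼ f Y + Q *+ n /\ f Y + P *+ n ≼ f X + Q *+ n >].

Fact unit_rel_refl : reflexive unit_rel.
Proof. by move=> X; apply/asboolP; exists 0%N; split; apply: c1le_refl. Qed.

Fact unit_rel_sym : symmetric unit_rel.
Proof. by move=> X Y; apply/asboolP/asboolP => -[n []]; exists n. Qed.

Fact unit_rel_trans : transitive unit_rel.
Proof.
have step (x y z p q p' q' : T) : x + p ≼ y + q -> y + p' ≼ z + q' ->
    x + (p + p') ≼ z + (q + q').
  move=> xy yz; apply: (c1le_trans _ (y + p' + q)).
    by rewrite addrA [X in _ ≼ X]addrAC; apply/c1le_add2r.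
  by rewrite [q + q']addrC addrA; apply/c1le_add2r.
move=> Y X Z /asboolP[m [XY YX]] /asboolP[n [YZ ZY]]; apply/asboolP.
exists (m + n)%N; rewrite !mulrnDr; split; first exact: step XY YZ.
by rewrite ![_ *+ m + _]addrC; apply: step ZY YX.
Qed.

Fact unit_rel_add X Y Z : unit_rel X Y -> unit_rel (X + Z) (Y + Z).
Proof.
move=> /asboolP[n [XY YX]]; apply/asboolP; exists n.
by rewrite !fD ![_ + f Z + _]addrAC !c1le_add2r.
Qed.

Fact unit_rel_oplus X Y Z : unit_rel X Y -> unit_rel (X ⊕ Z) (Y ⊕ Z).
Proof.
move=> /asboolP[n [XY YX]]; apply/asboolP; exists n; rewrite !f_oplus !add_oplusl.
have ZZ : f Z + P *+ n ≼ f Z + Q *+ n by apply/c1le_add2l/c1le_mulrn.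
by split; apply: c1le_oplus2.
Qed.

Definition unit_congr : congruence S :=
  @Congruence S (EquivRel unit_rel unit_rel_refl unit_rel_sym unit_rel_trans)
    unit_rel_add unit_rel_oplus.

Lemma unit_congr_cancellative : cancellative_congr unit_congr.
Proof.
move=> X Y Z /asboolP[n]; rewrite !fD -!addrA !c1le_add2l => YZ.
by apply/asboolP; exists n.
Qed.

End UnitCongruence.

(** Cancellativity of the quotient depends on the proof [canc], so the structure is packed as a
    function of it. *)
Definition canc_quot (S : char1Type) (c : congruence S)
    (canc : cancellative_congr c) : cancChar1Type :=
  HB.pack (quot c) (Char1_isCancellative.Build (quot c) (quot_add_cancel _ _ canc)).

Lemma maximal_archimedean (S : char1Type) (c : congruence S) :
  maximal_cancellative c -> archimedean (quot c).
Proof.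
move=> [canc _ maxc] P Q x y PQ neq_PQ.
pose c' := unit_congr S (canc_quot S c canc) (quot_proj c)
  (quot_projD S c) (quot_proj_oplus S c) P Q PQ.
have sub_c X Y : c X Y -> c' X Y.
  move=> /quot_projP XY; apply/asboolP; exists 0%N; rewrite XY.
  by split; exact: (c1le_refl (canc_quot S c canc) (quot_proj c Y + 0)).
have [eq_c|triv] := maxc c' (unit_congr_cancellative _ _ _ _ _ _ _ _) sub_c.
- case: neq_PQ; move: P Q PQ @c' sub_c eq_c.
  elim/quot_ind=> p; elim/quot_ind=> q pq c' _ eq_c; apply/quot_projP; rewrite -eq_c.
  have qp : quot_proj c q + quot_proj c p ≼ quot_proj c p + quot_proj c q.
    by rewrite addrC; exact: (c1le_refl (canc_quot S c canc)).
  (* For n = 1 the two conditions read P + P <= Q + Q and Q + P <= P + Q, so P and Q are identified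
     by c', hence by c. *)
  apply/asboolP; exists 1%N; split; last exact: qp.
  exact: (c1le_add (canc_quot S c canc) _ _ _ _ pq pq).
move: x y; elim/quot_ind=> X; elim/quot_ind=> Y.
by have /asboolP[n [XY _]] := triv X Y; exists n.
Qed.

(** * Identification of the quotient with the half-line or the whole line *)

Theorem theorem10 (K : realType) (R : perfCancChar1Type) (E : R)
    (hbounded : bounded_by_E E)
    (hseparated : separatedE K E)
    (hbanach : completeE K E)
    (c : congruence R)
    (hmax : maximal_cancellative c) :
  ((forall X1 : quot c, c1le 0 X1) ->
     (forall X1 : quot c,
        exists2 a : K, 0 <= a & X1 = quot_proj c (real_scale E a E)) /\
     exists f : quot c -> nneg_maxplus K,
       char1_iso f /\
       forall a : nneg_maxplus K,
         f (quot_proj c (real_scale E (nneg_val a) E)) = a)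
  /\
  ((exists X1 : quot c, ~ (0 ⊕ X1 = X1)) ->
     exists f : quot c -> maxplus K, char1_iso f).
Proof.
have [canc ntriv _] := hmax; have archi := maximal_archimedean _ _ hmax.
pose T := canc_quot _ _ canc; pose e : T := quot_proj c E.
have e_ge0 : 0 ≼ e by apply: quot_proj_le; apply: E_ge0.
(* If the class of E were 0, so would be that of every tE, and the bounds -tE <= Z <= tE would send
   every Z to 0, making the congruence trivial. *)
have e_neq0 : e <> 0.
  move=> e0; apply: ntriv => X Y; apply/quot_projP.
  suff H Z : quot_proj c Z = 0 by rewrite !H.
  have [t t0 [le1 le2]] := bounded_close0 _ E hbounded Z.
  have tE0 : quot_proj c (rat_scale t E) = 0.
    apply: (@c1le_anti T); last first.
      apply: quot_proj_le; apply: rat_scale_ge0 => //; exact: E_ge0 hbounded.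
    (* With t = n / d and d >= 1, tE <= d (tE) = n E, whose class is 0. *)
    have -> : 0 = (quot_proj c E : T) *+ `|numq t|%N by rewrite [quot_proj c E]e0 mul0rn.
    rewrite -[_ *+ _]quot_projMn -rat_scaleP; apply: quot_proj_le.
    rewrite -{1}[rat_scale t E]mulr1n; apply: c1le_mulrn_nat (absz_denq_gt0 t).
    by apply: rat_scale_ge0 => //; exact: E_ge0 hbounded.
  move: le1 le2 => /(quot_proj_le _ c) + /(quot_proj_le _ c).
  by rewrite !quot_projD tE0 !addr0 => ? ?; apply: (@c1le_anti T).
pose phi : T -> K := hoelder K T e.
have phiD : {morph phi : x y / x + y} := hoelderD K T archi e e_ge0 e_neq0.
have phi_inj : injective phi := hoelder_inj K T archi e e_ge0 e_neq0.
have phi_oplus x y : phi (x ⊕ y) = Num.max (phi x) (phi y).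
  exact: (hoelder_oplus K T archi e e_ge0 e_neq0).
have phi0 : phi 0 = 0 := hoelder0 K T archi e e_ge0 e_neq0.
have phi_scale (a : K) : 0 <= a -> phi (quot_proj c (real_scale E a E)) = a.
  move=> a0; apply: (real_scale_char K R E hbounded hbanach
                      (fun X => phi (quot_proj c X))) => //.
  - by move=> X Y; rewrite quot_projD phiD.
  - by move=> X Y /(quot_proj_le _ c); apply: (le_hoelder K T archi e e_ge0 e_neq0).
  - exact: (hoelder1 K T archi e e_ge0 e_neq0).
split=> [pos|[x1 x1_nge0]].
  have phi_ge0 x : 0 <= phi x.
    by rewrite -phi0; apply: (le_hoelder K T archi e e_ge0 e_neq0); apply: pos.
  have scale_phi x : quot_proj c (real_scale E (phi x) E) = x.
    by apply: phi_inj; apply: phi_scale.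
  split=> [x|]; first by exists (phi x).
  exists (fun x => NnegMaxplus (phi_ge0 x)); split; last first.
    by move=> a; apply: val_inj; apply: phi_scale; apply: nneg_valP.
  split.
  - exists (fun a => quot_proj c (real_scale E (nneg_val a) E)) => [x|a] /=.
      exact: scale_phi.
    by apply: val_inj; apply: phi_scale; apply: nneg_valP.
  - by apply: val_inj.
  - by move=> x y; apply: val_inj; apply: phiD.
  - by move=> x y; apply: val_inj; apply: phi_oplus.
have phi_x1 : phi x1 < 0.
  rewrite ltNge; apply/negP => ge0; apply: x1_nge0; apply: phi_inj.
  by rewrite phi_oplus phi0; apply/max_idPr.
have phiMn n : {morph phi : x / x *+ n} := hoelderMn K T archi e e_ge0 e_neq0 n.
have phi_surj (a : K) : exists x, phi x = a.
  have d0 : 0 <= `|a| / - phi x1 by rewrite divr_ge0 // oppr_ge0 ltW.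
  (* This n satisfies n (- phi x1) > |a|, so a - n phi x1 is nonnegative and hence the value of a
     real multiple of E; adding n x1 then gives an element of value a. *)
  pose n := Num.bound (`|a| / - phi x1).
  have : 0 <= a - phi (x1 *+ n).
    have := archi_boundP d0; rewrite -/n ltr_pdivrMr ?oppr_gt0// phiMn -mulr_natl.
    by have := ler_norm (- a); rewrite normrN; nra.
  move=> /phi_scale phi_b.
  by exists (quot_proj c (real_scale E (a - phi (x1 *+ n)) E) + x1 *+ n);
    rewrite phiD phi_b subrK.
have [g phiK] := choice phi_surj; exists phi; split=> //.
by exists g => // x; apply: phi_inj.
Qed.
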